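(* Let $n\geq 4$. For every point $P$ of the open standard cell $\Phi_n^{\circ}\subset\mathcal{M}_{0,n}(\mathbb{R})$, writing $u_{i,j}=u_{i,j}(P)$ for the dihedral coordinates of $P$, one has $$\sum_{\{i,j\}\in\chi_n} L(u_{i,j})=\frac{(n-3)(n-2)}{2}\,L(1),$$ where $L$ is the Rogers dilogarithm.
   Context: **Rogers dilogarithm.** For $|z|<1$, $Li_2(z)=\sum_{k\ge 1} z^k/k^2$. The Rogers dilogarithm $L:[0,1]\to\mathbb{R}$ is $L(x)=Li_2(x)+\frac12\log(x)\log(1-x)$ for $0<x<1$, extended by $L(0)=0$ and $L(1)=\pi^2/6$. **Index set.** Indices are taken modulo $n$ in $\{1,\dots,n\}$. $\chi_n$ is the set of the $n(n-3)/2$ unordered pairs $\{i,j\}$ such that $i,\,i+1,\,j,\,j+1$ are pairwise distinct modulo $n$ (equivalently, the strict chords, i.e. diagonals, of an $n$-gon with vertices numbered cyclically $1,\dots,n$). **Moduli space and dihedral coordinates.** $\mathcal{M}_{0,n}$ is the space of $n$-tuples $(z_1,\dots,z_n)$ of distinct points of $\mathbb{P}^1$ modulo the diagonal action of $\mathrm{PSL}_2$. For $\{i,j\}\in\chi_n$ the dihedral coordinate $u_{i,j}=u_{j,i}$ is the cross-ratio $$u_{i,j}=\frac{(z_i-z_{j+1})(z_{i+1}-z_j)}{(z_i-z_j)(z_{i+1}-z_{j+1})}.$$ **Standard cell.** $\Phi_n^{\circ}$ is the connected component of $\mathcal{M}_{0,n}(\mathbb{R})$ consisting of classes for which the marked points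 are in the natural cyclic order $z_1<z_2<\cdots<z_n<z_1$ on the circle $\mathbb{P}^1(\mathbb{R})$ (each such class has a representative with real $z_1<\cdots<z_n$). On it all $u_{i,j}$ lie in $(0,1)$. *)

(* Defs.v *)
From HB Require Import structures.
From mathcomp Require Import all_boot all_order all_algebra.
From mathcomp Require Import all_classical all_reals all_analysis.
From mathcomp Require Import ring.

Set Implicit Arguments.
Unset Strict Implicit.
Unset Printing Implicit Defensive.

Import Order.TTheory GRing.Theory Num.Theory.
Import numFieldNormedType.Exports.

Local Open Scope ring_scope.
Local Open Scope quotient_scope.

Section Rogers.
Variable R : realType.
Implicit Types x z : R.

Definition Li2 z : R := limn (series (fun k => z ^+ k.+1 / k.+1%:R ^+ 2)).

(* Only the values on [0, 1] are meaningful. *)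
Definition RogersL x : R :=
  if x == 0 then 0
  else if x == 1 then pi ^+ 2 / 6
  else Li2 x + 2^-1 * ln x * ln (1 - x).

End Rogers.

(* Indices are 0, ..., n - 1 instead of 1, ..., n, and i + 1 modulo n is
   [ordS i]. The unordered pair {i, j} is represented by (i, j) with i < j. *)
Definition chi (n : nat) : {set 'I_n * 'I_n} :=
  [set p : 'I_n * 'I_n | (p.1 < p.2)%N & uniq [:: p.1; ordS p.1; p.2; ordS p.2]].

(* The F-points of the projective line: [Some x] is x, [None] is infinity. *)
Definition P1 (F : fieldType) : choiceType := option F.

Section ModuliSpace.
Variable F : fieldType.
Implicit Types (x y : P1 F) (g h : 'M[F]_2).

(* Homogeneous coordinates [num : den]. *)
Definition hnum x : F := if x is Some a then a else 1.
Definition hden x : F := if x is Some _ then 1 else 0.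
Definition of_hom (a b : F) : P1 F := if b == 0 then None else Some (a / b).

Definition mobius g x : P1 F :=
  of_hom (g 0 0 * hnum x + g 0 1 * hden x) (g 1 0 * hnum x + g 1 1 * hden x).

(* The homogeneous form of x - y, equal to x - y when x and y are finite. In
   the cross-ratio below each point occurs once above and once below the
   fraction bar, so the choice of homogeneous coordinates is immaterial. *)
Definition pdiff x y : F := hnum x * hden y - hnum y * hden x.

Variable n : nat.

Record conf := Conf {
  conf_val :> {ffun 'I_n -> P1 F};
  conf_inj : injectiveb conf_val
}.
HB.instance Definition _ := [isSub for conf_val].
HB.instance Definition _ := [Choice of conf by <:].
Implicit Types z : conf.

(* The group of F-points of the algebraic group PSL_2 = PGL_2 is PGL_2(F), so
   the acting matrices are all the invertible ones. *)
Definition conf_equiv z1 z2 : bool :=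
  `[< exists2 g, g \in unitmx & forall i, z2 i = mobius g (z1 i) >].

Definition cross_ratio z (i j : 'I_n) : F :=
  (pdiff (z i) (z (ordS j)) * pdiff (z (ordS i)) (z j)) /
  (pdiff (z i) (z j) * pdiff (z (ordS i)) (z (ordS j))).

Lemma hom_neq0 x : (hnum x != 0) || (hden x != 0).
Proof. by case: x => [a|] /=; rewrite oner_neq0 ?orbT. Qed.

Lemma of_homZ c a b : c != 0 -> of_hom (c * a) (c * b) = of_hom a b.
Proof.
move=> c0; rewrite /of_hom mulf_eq0 (negPf c0) /=.
by case: eqP => // _; rewrite -mulf_div divff // mul1r.
Qed.

Lemma of_homK a b : (a != 0) || (b != 0) ->
  exists2 c, c != 0 & a = c * hnum (of_hom a b) /\ b = c * hden (of_hom a b).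
Proof.
rewrite /of_hom; case: (eqVneq b 0) => [-> | b0 _].
  by rewrite orbF => a0; exists a; rewrite //= mulr1 mulr0.
by exists b; rewrite //= mulr1 mulrC divfK.
Qed.

Lemma det2E g : \det g = g 0 0 * g 1 1 - g 0 1 * g 1 0.
Proof.
rewrite (expand_det_row _ 0) !big_ord_recl big_ord0 addr0 /cofactor !det_mx11.
rewrite !mxE /= expr0 expr1 mul1r mulN1r mulrN.
by congr (_ * g _ _ - g _ _ * g _ _); apply/val_inj.
Qed.

Lemma mobius_hom g x : g \in unitmx -> exists2 c, c != 0 &
  g 0 0 * hnum x + g 0 1 * hden x = c * hnum (mobius g x) /\
  g 1 0 * hnum x + g 1 1 * hden x = c * hden (mobius g x).
Proof.
rewrite unitmxE unitfE det2E => dg; apply: of_homK.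
rewrite -negb_and; apply/negP => /andP[/eqP e0 /eqP e1].
have := hom_neq0 x; apply/negP; rewrite negb_or !negbK.
have E0 : (g 0 0 * g 1 1 - g 0 1 * g 1 0) * hnum x = 0.
  transitivity (g 1 1 * (g 0 0 * hnum x + g 0 1 * hden x)
    - g 0 1 * (g 1 0 * hnum x + g 1 1 * hden x)); first by ring.
  by rewrite e0 e1; ring.
have E1 : (g 0 0 * g 1 1 - g 0 1 * g 1 0) * hden x = 0.
  transitivity (g 0 0 * (g 1 0 * hnum x + g 1 1 * hden x)
    - g 1 0 * (g 0 0 * hnum x + g 0 1 * hden x)); first by ring.
  by rewrite e0 e1; ring.
by move/eqP: E0; move/eqP: E1; rewrite !mulf_eq0 (negPf dg) /= => -> ->.
Qed.

Lemma mobius1 x : mobius 1%:M x = x.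
Proof.
rewrite /mobius !mxE /= !(mul1r, mul0r, addr0, add0r).
by case: x => [a|] /=; rewrite /of_hom ?oner_eq0 ?eqxx ?divr1.
Qed.

Lemma mobiusM g h x : h \in unitmx -> mobius (g *m h) x = mobius g (mobius h x).
Proof.
move=> uh; have [c c0 [e0 e1]] := mobius_hom x uh.
rewrite [RHS]/mobius -(of_homZ _ _ c0) !mulrDr !(mulrCA c) -e0 -e1.
rewrite /mobius !mxE !big_ord_recl !big_ord0.
rewrite (_ : lift ord0 ord0 = 1); last exact/val_inj.
by congr of_hom; ring.
Qed.

Lemma conf_equiv_refl : reflexive conf_equiv.
Proof.
move=> z; apply/asboolP; exists 1%:M; first exact: unitmx1.
by move=> i; rewrite mobius1.
Qed.

Lemma conf_equiv_sym : symmetric conf_equiv.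
Proof.
suff S z1 z2 : conf_equiv z1 z2 -> conf_equiv z2 z1.
  by move=> z1 z2; apply/idP/idP; exact: S.
move=> /asboolP[g ug e]; apply/asboolP; exists (invmx g).
  by rewrite unitmx_inv.
by move=> i; rewrite e -mobiusM // mulVmx // mobius1.
Qed.

Lemma conf_equiv_trans : transitive conf_equiv.
Proof.
move=> z2 z1 z3 /asboolP[g ug e] /asboolP[h uh e']; apply/asboolP.
exists (h *m g); first by rewrite unitmx_mul uh ug.
by move=> i; rewrite e' e mobiusM.
Qed.

Canonical conf_equiv_rel :=
  EquivRel conf_equiv conf_equiv_refl conf_equiv_sym conf_equiv_trans.

(* The set of F-points of the moduli space M_{0,n}. *)
Definition M0 := {eq_quot conf_equiv}.
HB.instance Definition _ := EqQuotient.on M0.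

Definition dihedral_coord (P : M0) (i j : 'I_n) : F := cross_ratio (repr P) i j.

Lemma pdiff_mobius g : g \in unitmx -> exists2 c : P1 F -> F,
  (forall x, c x != 0) & forall x y,
  \det g * pdiff x y = c x * c y * pdiff (mobius g x) (mobius g y).
Proof.
move=> ug; have ex x : exists c, (c != 0) &&
    ((g 0 0 * hnum x + g 0 1 * hden x == c * hnum (mobius g x)) &&
     (g 1 0 * hnum x + g 1 1 * hden x == c * hden (mobius g x))).
  have [c c0 [e0 e1]] := mobius_hom x ug.
  by exists c; rewrite c0 e0 e1 !eqxx.
exists (fun x => xchoose (ex x)) => [x|x y].
  by have /andP[] := xchooseP (ex x).
have /andP[_ /andP[/eqP x0 /eqP x1]] := xchooseP (ex x).
have /andP[_ /andP[/eqP y0 /eqP y1]] := xchooseP (ex y).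
have -> : forall a b : F, a * b * pdiff (mobius g x) (mobius g y) =
    a * hnum (mobius g x) * (b * hden (mobius g y)) -
    b * hnum (mobius g y) * (a * hden (mobius g x)).
  by move=> a b; rewrite /pdiff; ring.
rewrite -x0 -x1 -y0 -y1 det2E /pdiff; ring.
Qed.

Lemma cross_ratio_equiv z1 z2 i j :
  conf_equiv z1 z2 -> cross_ratio z1 i j = cross_ratio z2 i j.
Proof.
move=> /asboolP[g ug e]; rewrite /cross_ratio !e.
have [c c0 E] := pdiff_mobius ug.
set a := z1 i; set b := z1 (ordS i).
set a' := z1 j; set b' := z1 (ordS j).
have C0 : c a * c b * c a' * c b' != 0 by rewrite !mulf_neq0.
have D0 : \det g ^+ 2 != 0 by rewrite expf_neq0 // -unitfE -unitmxE.
have simpl k p q : k != 0 -> p / q = (k * p) / (k * q) :> F.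
  by move=> k0; rewrite -mulf_div divff // mul1r.
rewrite (simpl _ _ _ D0) [RHS](simpl _ _ _ C0).
congr (_ / _).
  transitivity ((\det g * pdiff a b') * (\det g * pdiff b a')); first by ring.
  by rewrite !E; ring.
transitivity ((\det g * pdiff a a') * (\det g * pdiff b b')); first by ring.
by rewrite !E; ring.
Qed.

Lemma dihedral_coordE z i j : dihedral_coord (\pi z) i j = cross_ratio z i j.
Proof.
by apply: cross_ratio_equiv; apply/eqmodP; rewrite reprK.
Qed.

Lemma dihedral_coordC (P : M0) i j : dihedral_coord P i j = dihedral_coord P j i.
Proof.
rewrite /dihedral_coord /cross_ratio /pdiff; congr (_ / _); ring.
Qed.

End ModuliSpace.

Section StandardCell.
Variable R : realType.

(* The linear order on P^1(R) obtained by cutting the circle at infinity, with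
   infinity as the largest element. *)
Definition P1_lt (x y : P1 R) : bool :=
  match x, y with
  | Some a, Some b => a < b
  | Some _, None => true
  | None, _ => false
  end.

(* x < y < z < x on the circle. *)
Definition cyclic3 (x y z : P1 R) : bool :=
  [|| P1_lt x y && P1_lt y z, P1_lt y z && P1_lt z x
    | P1_lt z x && P1_lt x y].

Definition cyclically_ordered n (z : conf R n) : Prop :=
  forall i j k : 'I_n, (i < j < k)%N -> cyclic3 (z i) (z j) (z k).

Definition standard_cell n : set (M0 R n) :=
  [set P | exists2 z : conf R n, P = \pi z & cyclically_ordered z]%classic.

End StandardCell.

(* Main.v *)
Require Import Defs.
From mathcomp Require Import all_boot all_order all_algebra.
From mathcomp Require Import all_classical all_reals all_analysis.
From mathcomp Require Import ring lra zify.

(** Lift the points z_k to vectors of R^2 whose determinants d_ij are positive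
    for i < j. With v(a,b,c,e) = d_ab d_ce / (d_ac d_be), the Pluecker relations
    show that the five-term relation of L says exactly that
    l(a,b,c,e) = L(v(a,b,c,e)) is a cocycle: l(b,c,e,f) is an alternating sum of
    values of l at quadruples starting with a. The reflection L(x) + L(1 - x) =
    L(1) turns the sum over the chords {i, j} into a sum of values
    l(i,i+1,j,j+1); expanding these from the base point 0, the sum telescopes.

    The five-term relation holds because its two sides have the same derivative
    in x and agree at x = 0. In the same way L(x) + L(1 - x) is constant; letting
    x tend to 0 shows that the constant is the sum of the inverse squares. This
    sum is evaluated by applying 1/sin^2 + 1/cos^2 = 4/sin^2 of the double angle
    to the angles (2j+1) pi / (4M), and comparing 1/sin^2 t with 1/t^2. *)

Set Implicit Arguments.
Unset Strict Implicit.
Unset Printing Implicit Defensive.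

Import Order.TTheory GRing.Theory Num.Theory.
Import numFieldNormedType.Exports.
Local Open Scope ring_scope.


(** * The dilogarithm series *)

Section PowerSeries.
Local Open Scope classical_set_scope.
Variable R : realType.
Implicit Types (c : R^nat) (x z : R).

(** Multiplied by (1 - z)^2, the partial sums have the closed form [E], so (1 - z)^-2 bounds
    them. *)
Lemma is_cvg_series_natmul_exp z : 0 <= z < 1 ->
  cvgn (series (fun k => k.+1%:R * z ^+ k)).
Proof.
move=> /andP[z0 z1]; apply: nondecreasing_is_cvgn.
  by apply: nondecreasing_series => k _ _; rewrite mulr_ge0 ?exprn_ge0.
exists ((1 - z) ^- 2) => _ [n _ <-] /=.
have E : (1 - z) ^+ 2 * series (fun k => k.+1%:R * z ^+ k) n
    = 1 - z ^+ n * (1 + n%:R * (1 - z)).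
  elim: n => [|n IH].
    by rewrite /series /= big_geq // expr0 mul0r addr0 !mulr1 mulr0 subrr.
  by rewrite /series /= big_nat_recr //= mulrDr [X in X + _]IH (exprS z n) -natr1; ring.
rewrite -[leRHS]mul1r ler_pdivlMr ?exprn_gt0 ?subr_gt0 // mulrC E gerBl.
by rewrite mulr_ge0 ?exprn_ge0 // addr_ge0 // mulr_ge0 // subr_ge0 ltW.
Qed.

Lemma is_cvg_pseries_lin_bound c M z :
  (forall k, `|c k| <= M * k.+1%:R) -> `|z| < 1 -> cvgn (pseries c z).
Proof.
move=> cM z1; apply: normed_cvg.
have M0 : 0 <= M by rewrite -(mulr1 M) (le_trans _ (cM 0%N)).
apply: (@series_le_cvg _ _ (fun k => M * (k.+1%:R * `|z| ^+ k))) => [k|k|k|].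
- exact: normr_ge0.
- by rewrite !mulr_ge0 ?exprn_ge0.
- by rewrite /= normrM normrX mulrA ler_wpM2r ?exprn_ge0.
- by apply: is_cvg_seriesZ; apply: is_cvg_series_natmul_exp; rewrite normr_ge0.
Qed.

(** Linear coefficient bounds make the series and its first two formal derivatives converge on the
    open unit disc, which justifies differentiating term by term. *)
Lemma is_derive_pseries c M x :
  (forall k, `|c k| <= M * k.+1%:R) ->
  (forall k, `|pseries_diffs c k| <= M * k.+1%:R) ->
  (forall k, `|pseries_diffs (pseries_diffs c) k| <= M * k.+1%:R) ->
  `|x| < 1 ->
  is_derive x (1 : R) (fun y => limn (pseries c y))
    (limn (pseries (pseries_diffs c) x)).
Proof.
move=> c0 c1 c2 x1.
(* The midpoint of |x| and 1 is the point where the three series are shown to converge. *)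
have K0 : 0 <= (1 + `|x|) / 2 by rewrite divr_ge0 // addr_ge0.
have K1 : `|(1 + `|x|) / 2| < 1 by rewrite ger0_norm //; lra.
apply: (@pseries_snd_diffs _ _ ((1 + `|x|) / 2)).
- exact: is_cvg_pseries_lin_bound c0 K1.
- exact: is_cvg_pseries_lin_bound c1 K1.
- exact: is_cvg_pseries_lin_bound c2 K1.
- by rewrite (ger0_norm K0); lra.
Qed.

(** Bridges [Li2], which starts at exponent 1, and [pseries], which starts at exponent 0. *)
Lemma lim_series_shift (f : R^nat) : f 0%N = 0 -> cvgn (series f) ->
  series (fun k => f k.+1) @ \oo --> limn (series f).
Proof.
move=> f0 cf; have -> : series (fun k => f k.+1) = (fun n => series f n.+1).
  by apply/funext => n; rewrite /series /= big_nat_recl //= f0 add0r.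
by rewrite cvg_shiftS.
Qed.

Lemma constant_on_itv (f : R -> R) (a b : R) : a <= b ->
  (forall x, x \in `]a, b[%R -> is_derive x 1 f 0) ->
  {within `[a, b], continuous f} -> f b = f a.
Proof.
move=> ab df cf; have [c _] := @MVT_segment _ f (fun=> 0) a b ab df cf.
by rewrite mul0r => /eqP; rewrite subr_eq0 => /eqP.
Qed.

Lemma within_continuous_itv (f : R -> R) (a b : R) :
  (forall x, a <= x <= b -> {for x, continuous f}) ->
  {within `[a, b], continuous f}.
Proof.
move=> cf; apply: continuous_in_subspaceT => x.
by rewrite inE /= in_itv /= => /cf.
Qed.

(** Since 0^-1 = 0, the term at [k = 0] drops out and the power series is that of -ln(1 - x). The
    same convention serves [dilog_coef]. *)
Definition ln_coef : R^nat := fun k => k%:R^-1.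

Definition dilog_coef : R^nat := fun k => k%:R ^- 2.

Lemma ln_coef_diffs : pseries_diffs ln_coef = cst 1.
Proof. by apply/funext => k; rewrite /pseries_diffs /ln_coef mulfV. Qed.

Lemma dilog_coef_diffs : pseries_diffs dilog_coef = (fun k => ln_coef k.+1).
Proof.
apply/funext => k; rewrite /pseries_diffs /dilog_coef /ln_coef.
by rewrite expr2 invfM mulrA mulfV ?mul1r.
Qed.

Lemma natrV_le1 k : k%:R^-1 <= 1 :> R.
Proof.
by case: k => [|k]; rewrite ?invr0 // invf_le1 // ler1n.
Qed.

Lemma ln_coef_bound k : `|ln_coef k| <= 1 * k.+1%:R.
Proof.
rewrite mul1r ger0_norm ?invr_ge0 //.
by rewrite (le_trans (natrV_le1 _)) // ler1n.
Qed.

Lemma dilog_coef_bound k : `|dilog_coef k| <= 1 * k.+1%:R.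
Proof.
rewrite mul1r ger0_norm ?invr_ge0 ?exprn_ge0 //.
rewrite (@le_trans _ _ 1) ?ler1n // /dilog_coef -exprVn.
by rewrite exprn_ile1 ?natrV_le1 // invr_ge0.
Qed.

Lemma is_derive_ln_series x : `|x| < 1 ->
  is_derive x (1 : R) (fun y => limn (pseries ln_coef y)) ((1 - x)^-1).
Proof.
move=> x1; apply: is_derive_eq.
  apply: (@is_derive_pseries _ 1) => // k; rewrite ?ln_coef_bound //.
    by rewrite ln_coef_diffs mul1r /= normr1 ler1n.
  by rewrite ln_coef_diffs /pseries_diffs /= mulr1 mul1r normr_nat.
rewrite ln_coef_diffs; apply: cvg_lim => //.
have -> : pseries (cst 1) x = series (geometric 1 x) by [].
by rewrite -[X in _ --> X]mul1r; exact: cvg_geometric_series.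
Qed.

Lemma is_derive_ln1B x : x < 1 ->
  is_derive x (1 : R) (fun y => ln (1 - y)) (- (1 - x)^-1).
Proof.
move=> x1; have x0 : 0 < 1 - x by rewrite subr_gt0.
have dl := is_derive1_ln x0.
have ds : is_derive x 1 (fun y : R => 1 - y) (-1).
  apply: (is_derive_eq (is_deriveB (is_derive_cst (1 : R^o) x 1) (is_derive_id x 1))).
  by rewrite sub0r.
have := @is_derive1_comp _ (@ln R) (fun y => 1 - y) x _ _ dl ds.
by rewrite mulrN1.
Qed.

(** The series plus ln(1 - x) has derivative 0 and vanishes at 0. *)
Lemma ln_seriesE x : 0 <= x < 1 -> limn (pseries ln_coef x) = - ln (1 - x).
Proof.
move=> /andP[x0 x1]; apply/eqP; rewrite -addr_eq0; apply/eqP.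
pose f : R -> R := fun y => limn (pseries ln_coef y) + ln (1 - y).
have df (y : R) : 0 <= y < 1 -> is_derive y 1 f 0.
  move=> /andP[y0 y1]; rewrite -(addrN (1 - y)^-1).
  by apply: is_deriveD; [apply: is_derive_ln_series; rewrite ger0_norm|
    exact: is_derive_ln1B].
rewrite -/(f x); have -> : f x = f 0.
  apply: constant_on_itv => // [y|].
    rewrite in_itv /= => /andP[y0 yx]; apply: df.
    by rewrite ltW //= (lt_trans yx).
  apply: within_continuous_itv => y /andP[y0 yx].
  apply/differentiable_continuous/derivable1_diffP.
  by have [] // := df y; rewrite y0 (le_lt_trans yx).
rewrite /f subr0 ln1 addr0; apply: cvg_lim => //.
apply: cvg_near_cst; near=> n.
rewrite /pseries /series /= big1 // => -[|k] _; rewrite /ln_coef.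
  by rewrite invr0 mul0r.
by rewrite expr0n mulr0.
Unshelve. all: by end_near.
Qed.

Lemma is_cvg_dilog x : `|x| < 1 -> cvgn (pseries dilog_coef x).
Proof. exact: is_cvg_pseries_lin_bound dilog_coef_bound. Qed.

Lemma cvg_Li2 x : `|x| < 1 ->
  series (fun k => x ^+ k.+1 / k.+1%:R ^+ 2) @ \oo --> limn (pseries dilog_coef x).
Proof.
move=> x1; have -> : (fun k => x ^+ k.+1 / k.+1%:R ^+ 2)
    = (fun k => dilog_coef k.+1 * x ^+ k.+1).
  by apply/funext => k; rewrite mulrC.
apply: (@lim_series_shift (fun k => dilog_coef k * x ^+ k)).
  by rewrite /dilog_coef expr0n invr0 mul0r.
exact: is_cvg_dilog.
Qed.

Lemma Li2E x : `|x| < 1 -> Li2 x = limn (pseries dilog_coef x).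
Proof. by move=> x1; apply: cvg_lim => //; exact: cvg_Li2. Qed.

Lemma Li2_0 : Li2 0 = 0 :> R.
Proof.
apply: cvg_lim => //; apply: cvg_near_cst; near=> n.
by rewrite /series /= big1 // => k _; rewrite expr0n mul0r.
Unshelve. all: by end_near.
Qed.

Lemma is_derive_Li2_series x : `|x| < 1 ->
  is_derive x (1 : R) (@Li2 R) (limn (pseries (fun k => ln_coef k.+1) x)).
Proof.
move=> x1; rewrite -dilog_coef_diffs.
apply: (@near_eq_is_derive _ _ _ (fun y => limn (pseries dilog_coef y))).
- near=> y; rewrite Li2E //.
  by near: y; apply: (@cvgr_norm_lt _ _ _ _ _ _ x) => //; exact: cvg_id.
- apply: (@is_derive_pseries _ 1) => // k; rewrite ?dilog_coef_bound //;
    rewrite dilog_coef_diffs mul1r ger0_norm /pseries_diffs /ln_coef.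
  + by rewrite (le_trans (natrV_le1 _)) // ler1n.
  + by rewrite invr_ge0.
  + by rewrite (@le_trans _ _ 1) ?ler1n // ler_pdivrMr // mul1r ler_nat.
  + by rewrite divr_ge0.
Unshelve. all: by end_near.
Qed.

Lemma is_derive_Li2 x : 0 < x < 1 ->
  is_derive x (1 : R) (@Li2 R) (- ln (1 - x) / x).
Proof.
move=> /andP[x0 x1]; have nx1 : `|x| < 1 by rewrite gtr0_norm.
apply: is_derive_eq; first exact: is_derive_Li2_series.
have c : cvgn (pseries (fun k => ln_coef k.+1) x).
  apply: (@is_cvg_pseries_lin_bound _ 1) => // k.
  rewrite mul1r ger0_norm ?invr_ge0 //.
  by rewrite (le_trans (natrV_le1 _)) // ler1n.
(* Multiplying by x turns the sum of x^k / (k+1) into the series of -ln(1 - x). *)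
apply: (mulIf (lt0r_neq0 x0)); rewrite divfK ?gt_eqF // -ln_seriesE ?(ltW x0) //.
have f0 : ln_coef 0%N * x ^+ 0 = 0 by rewrite /ln_coef invr0 mul0r.
have cl := is_cvg_pseries_lin_bound ln_coef_bound nx1.
have ls := @lim_series_shift (fun k => ln_coef k * x ^+ k) f0 cl.
rewrite -(cvg_lim (@Rhausdorff R) ls); apply/esym/cvg_lim => //.
have -> : series (fun k => ln_coef k.+1 * x ^+ k.+1)
    = (fun n => pseries (fun k => ln_coef k.+1) x n * x).
  apply/funext => n; rewrite /pseries /series /= mulr_suml.
  by apply: eq_bigr => k _; rewrite exprSr mulrA.
exact: cvgMr_tmp.
Qed.

End PowerSeries.

(** * Derivative and continuity of the Rogers dilogarithm *)

Section Rogers.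
Local Open Scope classical_set_scope.
Variable R : realType.
Implicit Types (x y t : R).

(** At 0 the special value agrees with the formula, because ln(1 - 0) = 0. *)
Lemma RogersLE x : x != 1 -> RogersL x = Li2 x + 2^-1 * ln x * ln (1 - x).
Proof.
rewrite /RogersL => /negPf ->; case: eqP => // ->.
by rewrite Li2_0 subr0 ln1 mulr0 addr0.
Qed.

Lemma RogersL0 : RogersL 0 = 0 :> R.
Proof. by rewrite /RogersL eqxx. Qed.

Lemma RogersL1 : RogersL 1 = pi ^+ 2 / 6 :> R.
Proof. by rewrite /RogersL oner_eq0 eqxx. Qed.

Lemma is_derive_RogersL t : 0 < t < 1 ->
  is_derive t (1 : R) (@RogersL R)
    (2^-1 * (- (ln t / (1 - t)) - ln (1 - t) / t)).
Proof.
move=> /andP[t0 t1].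
apply: (@near_eq_is_derive _ _ _ (fun y => Li2 y + 2^-1 * ln y * ln (1 - y))).
  near=> y; rewrite RogersLE // lt_eqF //.
  by near: y; exact: lt_nbhsl.
have dLi : is_derive t (1 : R) (@Li2 R) (- ln (1 - t) / t).
  by apply: is_derive_Li2; rewrite t0.
have dl := is_derive1_ln t0.
have dl1 := is_derive_ln1B t1.
have dl2 : is_derive t 1 (fun y : R => 2^-1 * ln y) (2^-1 * t^-1).
  exact: (is_deriveZ (2^-1 : R) dl).
have dM : is_derive t 1 (fun y : R => 2^-1 * ln y * ln (1 - y))
    (2^-1 * ln t * - (1 - t)^-1 + ln (1 - t) * (2^-1 * t^-1)).
  exact: (is_deriveM dl2 dl1).
have dD : is_derive t 1 (fun y : R => Li2 y + 2^-1 * ln y * ln (1 - y))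
    (- ln (1 - t) / t +
     (2^-1 * ln t * - (1 - t)^-1 + ln (1 - t) * (2^-1 * t^-1))).
  exact: (is_deriveD dLi dM).
apply: (is_derive_eq dD).
have t0' := gt_eqF t0; have t1' : 1 - t != 0 by rewrite subr_eq0 gt_eqF.
field; rewrite t0' t1' //.
Unshelve. all: by end_near.
Qed.

(** Grouping by ln t and ln(1 - t) lets coefficients be compared once the logarithms of products are
    split. *)
Lemma is_derive_RogersL_comp (t : R -> R) (dt x : R) :
  0 < t x < 1 -> is_derive x (1 : R) t dt ->
  is_derive x (1 : R) (fun y => RogersL (t y))
    (2^-1 * (- (ln (t x) * (dt / (1 - t x))) - ln (1 - t x) * (dt / t x))).
Proof.
move=> tx dtx; have dL := is_derive_RogersL tx.
have dC := @is_derive1_comp _ (@RogersL R) t x _ _ dL dtx.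
apply: (is_derive_eq dC); ring.
Qed.

(** Apply ln u < u to u = 1 / sqrt x for the first factor, and -ln(1 - x) <= x / (1 - x) <= 2x for
    the second. *)
Lemma ln_mul_ln1B_bound x : 0 < x <= 2^-1 ->
  `|ln x * ln (1 - x)| <= 4 * Num.sqrt x.
Proof.
move=> /andP[x0 x1]; have s0 : 0 < Num.sqrt x by rewrite sqrtr_gt0.
have sx := sqr_sqrtr (ltW x0).
have B : `|ln x| <= 2 / Num.sqrt x.
  have lx : ln x <= 0 by rewrite ln_le0 // (le_trans x1) // invf_le1 // ler1n.
  rewrite ler0_norm // -[in leLHS]sx lnXn // -mulNrn -lnV //.
  rewrite -[leLHS]mulr_natl ler_wpM2l // ltW // ln_sublinear // invr_gt0 //.
have C : `|ln (1 - x)| <= 2 * x.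
  have l1 : ln (1 - x) <= 0 by rewrite ln_le0 // gerBl ltW.
  have x2 : 0 < 1 - x by lra.
  rewrite ler0_norm // -lnV //.
  have -> : (1 - x)^-1 = 1 + x / (1 - x).
    by field; rewrite gt_eqF.
  apply: (le_trans (le_ln1Dx _)).
    by rewrite (@lt_trans _ _ 0) // ?divr_gt0 //; lra.
  by rewrite ler_pdivrMr //; nra.
rewrite normrM (le_trans (ler_pM _ _ B C)) //.
have -> : 2 / Num.sqrt x * (2 * x) = 4 * (x / Num.sqrt x).
  by field; rewrite gt_eqF.
by rewrite -[X in X / _]sx expr2 mulfK ?gt_eqF.
Qed.

Lemma cvg_ln_mul_ln1B : ln x * ln (1 - x) @[x --> (0 : R)] --> (0 : R).
Proof.
apply/cvgr0Pnorm_le => e e0; near=> x.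
have x1 : x < 2^-1 by near: x; apply: lt_nbhsl; rewrite invr_gt0.
(* This threshold makes the bound 4 sqrt x at most e. *)
have xe : x < (e / 4) ^+ 2.
  by near: x; apply: lt_nbhsl; rewrite exprn_gt0 // divr_gt0.
have [x0|x0] := leP x 0; first by rewrite (ln0 x0) mul0r normr0 ltW.
apply: (le_trans (ln_mul_ln1B_bound _)); first by rewrite x0 ltW.
move: xe => /ltW/ler_wsqrtr; rewrite sqrtr_sqr ger0_norm ?divr_ge0 ?(ltW e0) // => h.
lra.
Unshelve. all: by end_near.
Qed.

Lemma continuous_Li2_0 : {for 0, continuous (@Li2 R)}.
Proof.
apply/differentiable_continuous/derivable1_diffP.
by have [] := @is_derive_Li2_series R 0 _; rewrite ?normr0.
Qed.

(* Two-sided, because [ln] is 0 on negative numbers. *)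
Lemma continuous_RogersL_0 : {for 0, continuous (@RogersL R)}.
Proof.
rewrite /prop_for /continuous_at RogersL0.
have : Li2 x + 2^-1 * (ln x * ln (1 - x)) @[x --> (0 : R)] --> (0 : R).
  rewrite -[X in _ --> X]addr0; apply: cvgD.
    by have := continuous_Li2_0; rewrite /prop_for /continuous_at Li2_0.
  by rewrite -[X in _ --> X](mulr0 2^-1); apply: cvgMl_tmp; exact: cvg_ln_mul_ln1B.
apply: cvg_trans; apply: near_eq_cvg; near=> x.
rewrite RogersLE ?mulrA // lt_eqF //.
by near: x; exact: lt_nbhsl.
Unshelve. all: by end_near.
Qed.

Lemma continuous_RogersL t : 0 <= t < 1 -> {for t, continuous (@RogersL R)}.
Proof.
move=> /andP[]; rewrite le_eqVlt => /orP[/eqP <- _|t0 t1].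
  exact: continuous_RogersL_0.
apply/differentiable_continuous/derivable1_diffP.
by have [] // := @is_derive_RogersL t; rewrite t0.
Qed.

End Rogers.

(** * Five-term relation *)

Section FiveTerm.
Local Open Scope classical_set_scope.
Variable R : realType.
Implicit Types (x y s t : R).

Lemma is_derive_affine (a b x : R) :
  is_derive x (1 : R) (fun u : R => a + b * u) b.
Proof.
have h1 : is_derive x (1 : R) (fun u : R => b * u) (b * 1).
  exact: (is_deriveZ b (is_derive_id x 1)).
have h2 : is_derive x (1 : R) (fun u : R => a + b * u) (0 + b * 1).
  exact: (is_deriveD (is_derive_cst (a : R^o) x 1) h1).
by apply: (is_derive_eq h2); rewrite add0r mulr1.
Qed.

Lemma is_derive_mobius (a b c d x : R) : c + d * x != 0 ->
  is_derive x (1 : R) (fun u : R => (a + b * u) / (c + d * u))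
    ((b * c - a * d) / (c + d * x) ^+ 2).
Proof.
move=> q0; have hV := @is_deriveV _ (fun u : R => c + d * u) x d 1 q0
  (is_derive_affine c d x).
have hM : is_derive x (1 : R) (fun u : R => (a + b * u) / (c + d * u))
  ((a + b * x) * (- (c + d * x) ^- 2 * d) + (c + d * x)^-1 * b).
  exact: (is_deriveM (is_derive_affine a b x) hV).
by apply: (is_derive_eq hM); field.
Qed.

Lemma derive_continuous (f : R -> R) x df :
  is_derive x (1 : R) f df -> {for x, continuous f}.
Proof. by move=> [d _]; apply/differentiable_continuous/derivable1_diffP. Qed.

(* Spelled so that [is_derive_affine] and [is_derive_mobius] apply verbatim. *)
Let five_term_defect y s := RogersL s + RogersL y - RogersL (0 + y * s)
  - RogersL ((0 + (1 - y) * s) / (1 + - y * s))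
  - RogersL ((y + - y * s) / (1 + - y * s)).

Let mul_lt1 y s : 0 < y < 1 -> 0 <= s < 1 -> y * s < 1.
Proof. by move=> /andP[? ?] /andP[? ?]; nra. Qed.

Let continuous_five_term_defect y s : 0 < y < 1 -> 0 <= s < 1 ->
  {for s, continuous (five_term_defect y)}.
Proof.
move=> hy hs; have ys := mul_lt1 hy hs.
have q0 : 0 < 1 + - y * s by lra.
have cc (t : R -> R) : 0 <= t s < 1 -> {for s, continuous t} ->
    {for s, continuous (fun u => RogersL (t u))}.
  by move=> ts ct; apply: continuous_comp ct _; exact: continuous_RogersL.
apply: cvgB; last first.
  apply: (cc (fun u => (y + - y * u) / (1 + - y * u))).
    rewrite ltr_pdivrMr // divr_ge0 ?(ltW q0) //=; nra.
  apply: derive_continuous; apply: is_derive_mobius; exact: lt0r_neq0.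
apply: cvgB; last first.
  apply: (cc (fun u => (0 + (1 - y) * u) / (1 + - y * u))).
    rewrite ltr_pdivrMr // divr_ge0 ?(ltW q0) //=; nra.
  apply: derive_continuous; apply: is_derive_mobius; exact: lt0r_neq0.
apply: cvgB; last first.
  apply: (cc (fun u => 0 + y * u)); first nra.
  apply: derive_continuous; exact: is_derive_affine.
apply: cvgD; last exact: cvg_cst.
exact: continuous_RogersL.
Qed.

(** All five arguments and their complements to 1 are products and quotients of y, s, 1 - y, 1 - s
    and 1 - ys. After splitting the logarithms, the coefficients of these five logarithms cancel. *)
Let is_derive_five_term_defect y s : 0 < y < 1 -> 0 < s < 1 ->
  is_derive s (1 : R) (five_term_defect y) 0.
Proof.
move=> hy hs; have /andP[y0 y1] := hy; have /andP[s0 s1] := hs.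
have ys : y * s < 1 by apply: mul_lt1 => //; rewrite ltW.
have q0 : 0 < 1 + - y * s by lra.
have q0' := lt0r_neq0 q0.
have d1 := is_derive_RogersL hs.
have h3 : 0 < 0 + y * s < 1 by rewrite add0r mulr_gt0.
have d3 := @is_derive_RogersL_comp _ (fun u => 0 + y * u) _ s h3 (is_derive_affine 0 y s).
have h4 : 0 < (0 + (1 - y) * s) / (1 + - y * s) < 1.
  rewrite ltr_pdivrMr // divr_gt0 //=; nra.
have d4 := @is_derive_RogersL_comp _
    (fun u => (0 + (1 - y) * u) / (1 + - y * u)) _ s h4 (is_derive_mobius 0 (1 - y) q0').
have h5 : 0 < (y + - y * s) / (1 + - y * s) < 1.
  rewrite ltr_pdivrMr // divr_gt0 //=; nra.
have d5 := @is_derive_RogersL_comp _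
    (fun u => (y + - y * u) / (1 + - y * u)) _ s h5 (is_derive_mobius y (- y) q0').
have D := is_deriveB (is_deriveB (is_deriveB (is_deriveD d1
  (is_derive_cst (RogersL y : R^o) s 1)) d3) d4) d5.
apply: (is_derive_eq D).
have y1' : 0 < 1 - y by lra.
have s1' : 0 < 1 - s by lra.
have -> : 1 - (0 + (1 - y) * s) / (1 + - y * s) = (1 - s) / (1 + - y * s).
  by field.
have -> : 1 - (y + - y * s) / (1 + - y * s) = (1 - y) / (1 + - y * s).
  by field.
have -> : y + - y * s = y * (1 - s) by ring.
have -> : 1 - (0 + y * s) = 1 + - y * s by ring.
rewrite !add0r !ln_div ?posrE ?mulr_gt0 // !lnM ?posrE //.
by field; rewrite !lt0r_neq0.
Qed.

Lemma RogersL_five_term x y : 0 < x < 1 -> 0 < y < 1 ->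
  RogersL x + RogersL y = RogersL (x * y)
    + RogersL (x * (1 - y) / (1 - x * y)) + RogersL (y * (1 - x) / (1 - x * y)).
Proof.
move=> hx hy; have /andP[x0 x1] := hx.
have E : five_term_defect y x = five_term_defect y 0.
  apply: constant_on_itv => [|s|]; first exact: ltW.
    rewrite in_itv /= => /andP[s0 sx]; apply: is_derive_five_term_defect => //.
    by rewrite s0 (lt_trans sx).
  apply: within_continuous_itv => s /andP[s0 sx].
  by apply: continuous_five_term_defect; rewrite // s0 (le_lt_trans sx).
have : five_term_defect y x = 0.
  (* At s = 0 the arguments are 0, y, 0, 0, y. *)
  by rewrite E /five_term_defect !mulr0 !addr0 mul0r divr1 RogersL0; ring.
rewrite /five_term_defect => E0.
have -> : x * (1 - y) / (1 - x * y) = (0 + (1 - y) * x) / (1 + - y * x).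
  by congr (_ / _); ring.
have -> : y * (1 - x) / (1 - x * y) = (y + - y * x) / (1 + - y * x).
  by congr (_ / _); ring.
have -> : x * y = 0 + y * x by ring.
by lra.
Qed.

(** The value at 1/2 only names the constant; [RogersL_reflection] identifies it through the limit
    at 0. *)
Lemma RogersL_reflection_const x : 0 < x < 1 ->
  RogersL x + RogersL (1 - x) = RogersL 2^-1 + RogersL (1 - 2^-1).
Proof.
pose f : R -> R := fun t => RogersL t + RogersL (1 + -1 * t).
have df t : 0 < t < 1 -> is_derive t (1 : R) f 0.
  move=> ht; have /andP[t0 t1] := ht.
  have h2 : 0 < 1 + -1 * t < 1 by lra.
  have d := @is_derive_RogersL_comp _ (fun u => 1 + -1 * u) _ t h2
    (is_derive_affine 1 (-1) t).
  have D := is_deriveD (is_derive_RogersL ht) d.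
  apply: (is_derive_eq D).
  have -> : 1 - (1 + -1 * t) = t by ring.
  have -> : 1 + -1 * t = 1 - t by ring.
  have t1' : 1 - t != 0 by rewrite subr_eq0 gt_eqF.
  by field; rewrite t1' lt0r_neq0.
have C (a b : R) : 0 < a -> b < 1 -> a <= b -> f b = f a.
  move=> a0 b1 ab; apply: constant_on_itv => // [t|].
    by rewrite in_itv /= => /andP[ta tb]; apply: df; lra.
  apply: within_continuous_itv => t /andP[ta tb].
  by apply: (@derive_continuous _ _ 0); apply: df; lra.
move=> /andP[x0 x1]; have E t : RogersL t + RogersL (1 - t) = f t.
  by rewrite /f mulN1r.
rewrite !E; have [h|/ltW h] := leP x 2^-1.
  by rewrite (C x 2^-1) //; lra.
by rewrite (C 2^-1 x) //; lra.
Qed.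

End FiveTerm.

(** * Basel problem *)

Section Basel.
Variable R : realType.
Implicit Types (x : R) (M N m : nat).

(** By the mean value theorem sin x = x cos c with 0 < c < x, and the cosine decreases there. *)
Lemma sin_bounds x : 0 < x < pi / 2 -> x * cos x <= sin x <= x.
Proof.
move=> /andP[x0 xpi].
have [c] := @MVT _ (@sin R) (@cos R) 0 x x0 (fun y _ => is_derive_sin y)
  (continuous_subspaceT (@continuous_sin R)).
rewrite in_itv /= sin0 !subr0 => /andP[c0 cx] ->.
rewrite ler_piMl ?cos_le1 ?(ltW x0) // andbT mulrC ler_wpM2r ?(ltW x0) //.
by apply: ltW; rewrite ltr_cos // in_itv /=; have := @pi_gt0 R; lra.
Qed.

(** The upper bound is x^2 cos^2 x <= sin^2 x rewritten as x^2 <= (1 + x^2) sin^2 x. *)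
Lemma sin_inv_sqr_bounds x : 0 < x < pi / 2 ->
  x ^- 2 <= (sin x) ^- 2 <= x ^- 2 + 1.
Proof.
move=> hx; have s0 := sin_gt0_pihalf hx; have /andP[x0 xpi] := hx.
have c0 : 0 < cos x by apply: cos_gt0_pihalf; have := @pi_gt0 R; lra.
have /andP[lo up] := sin_bounds hx.
have x2 : 0 < x ^+ 2 by rewrite exprn_gt0.
have s2 : 0 < sin x ^+ 2 by rewrite exprn_gt0.
rewrite lef_pV2 ?posrE // lerXn2r ?nnegrE ?(ltW x0) ?(ltW s0) //=.
have -> : x ^- 2 + 1 = (1 + x ^+ 2) / x ^+ 2 by field; exact: lt0r_neq0.
rewrite ler_pdivlMr // mulrC ler_pdivrMr //.
have : (x * cos x) ^+ 2 <= sin x ^+ 2.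
  by rewrite lerXn2r ?nnegrE ?mulr_ge0 ?(ltW x0) ?(ltW c0) ?(ltW s0).
rewrite exprMn cos2sin2; lra.
Qed.

Lemma sin_inv_sqr_double x : sin x != 0 -> cos x != 0 ->
  (sin x) ^- 2 + (cos x) ^- 2 = 4 * (sin (x *+ 2)) ^- 2.
Proof.
move=> s0 c0; rewrite sin_mulr2n.
transitivity ((cos x ^+ 2 + sin x ^+ 2) / (sin x ^+ 2 * cos x ^+ 2)).
  by field; rewrite s0 c0.
by rewrite cos2Dsin2; field; rewrite s0 c0.
Qed.

Definition odd_angle M j : R := j.*2.+1%:R * pi / (4 * M%:R).

Lemma odd_angle_itv M j : (j < M)%N -> 0 < odd_angle M j < pi / 2.
Proof.
move=> jM; have p0 := @pi_gt0 R; have M0 : (0 : R) < M%:R by rewrite ltr0n; lia.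
apply/andP; split; first by rewrite /odd_angle divr_gt0 // mulr_gt0 // ltr0n.
rewrite /odd_angle ltr_pdivrMr ?mulr_gt0 //.
have -> : pi / 2 * (4 * M%:R) = (M.*2)%:R * pi :> R.
  by rewrite -muln2 natrM; field.
by rewrite ltr_pM2r // ltr_nat; lia.
Qed.

Definition sin_inv_sqr_sum M : R := \sum_(0 <= j < M) (sin (odd_angle M j)) ^- 2.

(* The terms j and 2M - 1 - j have complementary angles, and
   1/sin^2 + 1/cos^2 = 4/sin^2 of the double angle. *)
Lemma sin_inv_sqr_sum_double M :
  sin_inv_sqr_sum M.*2 = 4 * sin_inv_sqr_sum M.
Proof.
rewrite /sin_inv_sqr_sum (@big_cat_nat _ _ _ M) /=; [|by []|lia].
have E (F : nat -> R) :
    \sum_(M <= j < M.*2) F j = \sum_(0 <= j < M) F (M.*2 - j.+1)%N.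
  transitivity (\sum_(0 + M <= j < M.*2) F j); first by [].
  rewrite big_addn (_ : M.*2 - M = M)%N; last lia.
  by rewrite big_nat_rev; apply: eq_big_nat => j jM; congr F; lia.
rewrite E -big_split /= mulr_sumr; apply: eq_big_nat => j /andP[_ jM].
have a := @odd_angle_itv M.*2 j ltac:(lia).
have s0 := sin_gt0_pihalf a.
have c0 : 0 < cos (odd_angle M.*2 j).
  by apply: cos_gt0_pihalf; have := @pi_gt0 R; move/andP: a; lra.
have M0 : M%:R != 0 :> R by rewrite pnatr_eq0; lia.
have -> : odd_angle M j = odd_angle M.*2 j *+ 2.
  by rewrite /odd_angle -[M.*2]muln2 natrM; field.
have -> : odd_angle M.*2 (M.*2 - j.+1) = - odd_angle M.*2 j + pi / 2.
  rewrite /odd_angle (_ : (M.*2 - j.+1).*2.+1 = 4 * M - j.*2.+1)%N;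
    last lia.
  rewrite natrB ?natrM -?[M.*2]muln2 ?natrM; last lia.
  by field.
by rewrite sinDpihalf cosN sin_inv_sqr_double // lt0r_neq0.
Qed.

Lemma sin_inv_sqr_sum_pow2 m : sin_inv_sqr_sum (2 ^ m) = 2 * (2 ^ m)%:R ^+ 2.
Proof.
elim: m => [|m IH].
  rewrite /sin_inv_sqr_sum expn0 big_nat1 expr1n mulr1 /odd_angle.
  have -> : (0.*2.+1)%:R * pi / (4 * 1%:R) = pi / 4 :> R by rewrite mul1r mulr1.
  have p : 0 < pi / 4 :> R by rewrite divr_gt0 ?pi_gt0.
  have c : cos (pi / 4) != 0 :> R.
    by rewrite lt0r_neq0 //; apply: cos_gt0_pihalf; lra.
  (* From tan(pi/4) = 1 the sine and cosine agree, so sin^2 = 1/2 and the single term is 2. *)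
  have := @tan_piquarter R; rewrite /tan => /(canRL (mulfVK c)); rewrite mul1r => E.
  have := cos2Dsin2 (pi / 4 : R); rewrite -E => E2.
  have -> : sin (pi / 4 : R) ^+ 2 = 2^-1 by lra.
  by rewrite invrK.
by rewrite expnS mul2n sin_inv_sqr_sum_double IH -mul2n natrM; ring.
Qed.

Definition odd_inv_sqr_sum M : R := \sum_(0 <= j < M) (j.*2.+1)%:R ^- 2.

(** Replacing 1/sin^2 t by 1/t^2 costs at most 1 per term, hence at most M out of 2 M^2 in all.
    Dividing by the scale factor 16 M^2 / pi^2 gives the stated error. *)
Lemma odd_inv_sqr_sum_bounds m :
  pi ^+ 2 / 8 - pi ^+ 2 / (16 * (2 ^ m)%:R)
    <= odd_inv_sqr_sum (2 ^ m) <= pi ^+ 2 / 8.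
Proof.
set M := (2 ^ m)%N; have M0 : (0 : R) < M%:R by rewrite ltr0n expn_gt0.
have p0 := @pi_gt0 R; have p2 : 0 < pi ^+ 2 :> R by rewrite exprn_gt0.
have T : sin_inv_sqr_sum M = 2 * M%:R ^+ 2 by rewrite sin_inv_sqr_sum_pow2.
have S : \sum_(0 <= j < M) (odd_angle M j) ^- 2
    = 16 * M%:R ^+ 2 / pi ^+ 2 * odd_inv_sqr_sum M.
  rewrite mulr_sumr; apply: eq_bigr => j _; rewrite /odd_angle.
  have k0 : (j.*2.+1)%:R != 0 :> R by rewrite pnatr_eq0.
  move: (lt0r_neq0 p0) (lt0r_neq0 M0) k0.
  move: (j.*2.+1)%:R (pi : R) (M%:R : R) => k p q q0 p0' k0.
  by field; rewrite q0 p0' k0.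
have L : 16 * M%:R ^+ 2 / pi ^+ 2 * odd_inv_sqr_sum M <= 2 * M%:R ^+ 2.
  rewrite -S -T /sin_inv_sqr_sum; apply: ler_sum_nat => j /andP[_ jM].
  by have /andP[] := sin_inv_sqr_bounds (odd_angle_itv jM).
have U : 2 * M%:R ^+ 2 <= 16 * M%:R ^+ 2 / pi ^+ 2 * odd_inv_sqr_sum M + M%:R.
  rewrite -S -T /sin_inv_sqr_sum.
  have -> : M%:R = \sum_(0 <= j < M) (1 : R) by rewrite sumr_const_nat subn0.
  rewrite -big_split /=; apply: ler_sum_nat => j /andP[_ jM].
  by have /andP[] := sin_inv_sqr_bounds (odd_angle_itv jM).
have k0 : 0 < 16 * M%:R ^+ 2 / pi ^+ 2 :> R by rewrite divr_gt0 // mulr_gt0 ?exprn_gt0.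
apply/andP; split; rewrite -(ler_pM2l k0).
  rewrite [leLHS](_ : _ = 2 * M%:R ^+ 2 - M%:R); first lra.
  move: (lt0r_neq0 p0) (lt0r_neq0 M0); move: (pi : R) (M%:R : R) => p q p0' q0.
  by field; rewrite p0' q0.
rewrite [leRHS](_ : _ = 2 * M%:R ^+ 2) //.
move: (lt0r_neq0 p0); move: (pi : R) => p p0'; by field.
Qed.

Definition inv_sqr_sum N : R := \sum_(0 <= k < N) k.+1%:R ^- 2.

Lemma inv_sqr_sum_double M :
  inv_sqr_sum M.*2 = odd_inv_sqr_sum M + inv_sqr_sum M / 4.
Proof.
elim: M => [|M IH].
  by rewrite /inv_sqr_sum /odd_inv_sqr_sum !big_geq // mul0r addr0.
rewrite /inv_sqr_sum /odd_inv_sqr_sum doubleS !big_nat_recr //=.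
rewrite -/(inv_sqr_sum M.*2) -/(odd_inv_sqr_sum M) -/(inv_sqr_sum M) IH.
have -> : M.*2.+2%:R ^- 2 = M.+1%:R ^- 2 / 4 :> R.
  have : M.+1%:R != 0 :> R by rewrite pnatr_eq0.
  by rewrite -doubleS -muln2 natrM; move: (M.+1%:R : R) => k k0; field.
by ring.
Qed.

(** The value pi^2/6 is the fixed point of s = pi^2/8 + s/4, and the errors add up exactly: 1/16 +
    1/16 = 1/8 in units of pi^2 / 2^m. *)
Lemma inv_sqr_sum_bounds m :
  pi ^+ 2 / 6 - pi ^+ 2 / (4 * (2 ^ m)%:R)
    <= inv_sqr_sum (2 ^ m) <= pi ^+ 2 / 6.
Proof.
have p2 : 0 < pi ^+ 2 :> R by rewrite exprn_gt0 // pi_gt0.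
elim: m => [|m IH].
  (* For m = 0 this reads 1 <= pi^2/8, which implies the upper bound; the lower bound is
     negative. *)
  have := odd_inv_sqr_sum_bounds 0.
  rewrite /inv_sqr_sum /odd_inv_sqr_sum expn0 !big_nat1 expr1n invr1 !mulr1.
  by move=> /andP[_ ?]; apply/andP; split; lra.
have M0 : (0 : R) < (2 ^ m)%:R by rewrite ltr0n expn_gt0.
rewrite expnS mul2n inv_sqr_sum_double -mul2n natrM.
move: IH (odd_inv_sqr_sum_bounds m) => /andP[i1 i2] /andP[b1 b2].
apply/andP; split; last by lra.
have E (k : R) : k != 0 ->
    pi ^+ 2 / (k * (2 ^ m)%:R) = k^-1 * (pi ^+ 2 / (2 ^ m)%:R).
  move=> k0; move: (lt0r_neq0 M0); move: (pi : R) (((2 ^ m)%N)%:R : R) => p q q0.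
  by field; rewrite k0 q0.
move: i1 b1; rewrite [4 * (2 * _)]mulrA !E ?mulf_neq0 //.
have : 0 < pi ^+ 2 / (2 ^ m)%:R :> R by rewrite divr_gt0.
set q := pi ^+ 2 / (2 ^ m)%:R; lra.
Qed.

Lemma inv_sqr_sum_le N : inv_sqr_sum N <= pi ^+ 2 / 6.
Proof.
have /andP[_] := inv_sqr_sum_bounds N; apply: le_trans.
rewrite /inv_sqr_sum [leRHS](@big_cat_nat _ _ _ N) //=; last exact/ltnW/ltn_expl.
by rewrite lerDl sumr_ge0.
Qed.

Lemma inv_sqr_sum_sup C : (forall N, inv_sqr_sum N <= C) -> pi ^+ 2 / 6 <= C.
Proof.
move=> hC; apply/ler_addgt0Pr => e e0.
have p2 : 0 < pi ^+ 2 :> R by rewrite exprn_gt0 // pi_gt0.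
(* Then 2^m >= m + 1 > pi^2 / (4e), so the error term is at most e. *)
pose m := Num.truncn (pi ^+ 2 / (4 * e)).
have M0 : (0 : R) < (2 ^ m)%:R by rewrite ltr0n expn_gt0.
have /andP[lo _] := inv_sqr_sum_bounds m.
have hm : pi ^+ 2 / (4 * e) <= (2 ^ m)%:R.
  apply: ltW; apply: lt_le_trans (truncnS_gt _) _.
  by rewrite ler_nat ltn_expl.
have : pi ^+ 2 / (4 * (2 ^ m)%:R) <= e.
  move: hm; rewrite !ler_pdivrMr ?mulr_gt0 //; lra.
by have := hC (2 ^ m)%N; lra.
Qed.

End Basel.

(** * Reflection formula *)

Section Reflection.
Local Open Scope classical_set_scope.
Variable R : realType.
Implicit Types (x y s t : R).

Lemma nondecreasing_Li2_series x : 0 <= x ->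
  nondecreasing_seq (series (fun k => x ^+ k.+1 / k.+1%:R ^+ 2)).
Proof.
by move=> x0; apply: nondecreasing_series => k _ _; rewrite divr_ge0 ?exprn_ge0.
Qed.

Lemma Li2_le x : 0 <= x < 1 -> Li2 x <= pi ^+ 2 / 6.
Proof.
move=> /andP[x0 x1]; have nx1 : `|x| < 1 by rewrite ger0_norm.
apply: limr_le; first by apply/cvg_ex; eexists; exact: cvg_Li2.
apply: nearW => n; apply: le_trans (inv_sqr_sum_le R n).
rewrite /series /inv_sqr_sum; apply: ler_sum_nat => k _.
rewrite -[leRHS]mul1r ler_wpM2r ?invr_ge0 ?exprn_ge0 //.
by rewrite exprn_ile1 // ltW.
Qed.

Lemma bernoulli_1B x n : 0 <= x <= 1 -> 1 - n%:R * x <= (1 - x) ^+ n.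
Proof.
move=> /andP[x0 x1]; elim: n => [|n IH]; first by rewrite mul0r subr0.
have n0 : 0 <= n%:R * (x * x) by rewrite !mulr_ge0.
have : (1 - x) * (1 - n%:R * x) <= (1 - x) * (1 - x) ^+ n.
  by rewrite ler_wpM2l // subr_ge0.
rewrite exprS -natr1; lra.
Qed.

(** Keep the first N terms; Bernoulli's inequality bounds the loss in each by x / (k+1) <= x. Since
    N is fixed, x may then tend to 0. *)
Lemma Li2_1B_ge x N : 0 < x < 1 ->
  inv_sqr_sum R N - N%:R * x <= Li2 (1 - x).
Proof.
move=> /andP[x0 x1]; have nx1 : `|1 - x| < 1 by rewrite gtr0_norm; lra.
have x1' : 0 <= 1 - x by lra.
have cv : cvgn (series (fun k => (1 - x) ^+ k.+1 / k.+1%:R ^+ 2)).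
  by apply/cvg_ex; eexists; exact: cvg_Li2.
apply: le_trans (nondecreasing_cvgn_le (nondecreasing_Li2_series x1') cv N).
rewrite /series /inv_sqr_sum /=.
have -> : N%:R * x = \sum_(0 <= k < N) x by rewrite sumr_const_nat subn0 mulr_natl.
rewrite -sumrB; apply: ler_sum_nat => k _.
have k0 : (0 : R) < k.+1%:R ^+ 2 by rewrite exprn_gt0.
rewrite ler_pdivlMr // mulrBl mulVf ?gt_eqF //.
apply: le_trans (bernoulli_1B k.+1 _); last by rewrite !ltW.
rewrite lerB // [leRHS]mulrC ler_wpM2r ?(ltW x0) // expr2 ler_peMl // ler1n //.
Qed.

(** Write Li2(1 - t) = C - g(t) with g(t) tending to 0. The upper bound on [Li2] gives C <= pi^2/6.
    The lower bound gives, for each fixed N as t tends to 0, that C dominates the N-th partial sum,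
    hence their supremum pi^2/6. *)
Lemma RogersL_reflection x : 0 < x < 1 ->
  RogersL x + RogersL (1 - x) = RogersL 1.
Proof.
move=> hx; rewrite (RogersL_reflection_const hx) RogersL1.
set C := RogersL _ + _.
pose g t : R := Li2 t + ln t * ln (1 - t).
have g0 : g t @[t --> (0 : R)^'+] --> (0 : R).
  apply: cvg_at_right_filter; rewrite -[X in _ --> X]addr0; apply: cvgD.
    by have := @continuous_Li2_0 R; rewrite /prop_for /continuous_at Li2_0.
  exact: cvg_ln_mul_ln1B.
have E t : 0 < t < 1 -> Li2 (1 - t) = C - g t.
  move=> ht; rewrite /C -(RogersL_reflection_const ht) /g.
  move/andP: ht => [t0 t1]; rewrite !RogersLE ?lt_eqF //; last lra.
  have -> : 1 - (1 - t) = t by ring.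
  by field.
apply/eqP; rewrite eq_le; apply/andP; split.
  have L : C - g t @[t --> (0 : R)^'+] --> C - 0 by apply: cvgB => //; exact: cvg_cst.
  rewrite -[C]subr0; apply: (cvgr_to_le L); near=> t.
  have t0 : 0 < t by [].
  have t1 : t < 1 by near: t; apply: nbhs_right_lt.
  by rewrite -E ?t0 // Li2_le //; lra.
apply: inv_sqr_sum_sup => N.
have L : inv_sqr_sum R N - N%:R * t + g t @[t --> (0 : R)^'+]
    --> inv_sqr_sum R N - N%:R * 0 + 0.
  apply: cvgD => //; apply: cvgB; first exact: cvg_cst.
  by apply: cvgMl_tmp; apply: cvg_at_right_filter; exact: cvg_id.
rewrite mulr0 subr0 addr0 in L.
apply: (cvgr_to_le L); near=> t.
have t0 : 0 < t by [].
have t1 : t < 1 by near: t; apply: nbhs_right_lt.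
have ht : 0 < t < 1 by rewrite t0.
by have := Li2_1B_ge N ht; rewrite E //; lra.
Unshelve. all: by end_near.
Qed.

End Reflection.

(** * Summation over the chords *)

Section Cocycle.
Variables (R : realType) (n : nat) (d : nat -> nat -> R).
Hypothesis d_gt0 : forall i j, (i < j < n)%N -> 0 < d i j.
Hypothesis d_anti : forall i j, d j i = - d i j.
Hypothesis d_plucker : forall a b c e,
  d a b * d c e + d a e * d b c = d a c * d b e.

(** The v of the overview. By [d_plucker] its complement to 1 has the same denominator and the
    remaining product of determinants as numerator. *)
Definition dcross a b c e := d a b * d c e / (d a c * d b e).

Let d_neq0 i j : (i < j < n)%N -> d i j != 0.
Proof. by move=> /d_gt0; exact: lt0r_neq0. Qed.

Lemma dcross_itv a b c e : (a < b < c)%N -> (c < e < n)%N ->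
  0 < dcross a b c e < 1.
Proof.
move=> abc cen; have dac : 0 < d a c by apply: d_gt0; lia.
have dbe : 0 < d b e by apply: d_gt0; lia.
have dab : 0 < d a b by apply: d_gt0; lia.
have dce : 0 < d c e by apply: d_gt0; lia.
have dae : 0 < d a e by apply: d_gt0; lia.
have dbc : 0 < d b c by apply: d_gt0; lia.
rewrite /dcross divr_gt0 ?mulr_gt0 //= ltr_pdivrMr ?mulr_gt0 // mul1r.
by rewrite -(d_plucker a b c e) ltrDl mulr_gt0.
Qed.

Lemma onem_dcross a b c e : (a < b < c)%N -> (c < e < n)%N ->
  1 - dcross a b c e = d a e * d b c / (d a c * d b e).
Proof.
move=> abc cen; have dac : d a c != 0 by apply: d_neq0; lia.
have dbe : d b e != 0 by apply: d_neq0; lia.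
apply: (@mulIf _ (d a c * d b e)); first by rewrite mulf_neq0.
rewrite mulrBl mul1r !divfK ?mulf_neq0 // -(d_plucker a b c e).
by rewrite addrC addKr.
Qed.

Definition rogers4 a b c e := RogersL (dcross a b c e).

(** Five-term relation at x = v(a,c,e,f) and y = v(a,b,c,f): the product xy is v(a,b,e,f), and the
    two quotients are v(b,c,e,f) and v(a,b,c,e). *)
Lemma rogers4_cocycle a b c e f : (a < b < c)%N -> (c < e < f)%N -> (f < n)%N ->
  rogers4 b c e f = rogers4 a c e f - rogers4 a b e f
    + rogers4 a b c f - rogers4 a b c e.
Proof.
move=> abc cef fn.
have hx : 0 < dcross a c e f < 1 by apply: dcross_itv; lia.
have hy : 0 < dcross a b c f < 1 by apply: dcross_itv; lia.
have := RogersL_five_term hx hy; rewrite /rogers4.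
have nz i j : (i < j < n)%N -> d i j != 0 by exact: d_neq0.
have ab := nz a b ltac:(clear -abc cef fn; lia).
have ac := nz a c ltac:(clear -abc cef fn; lia).
have ae := nz a e ltac:(clear -abc cef fn; lia).
have af := nz a f ltac:(clear -abc cef fn; lia).
have bc := nz b c ltac:(clear -abc cef fn; lia).
have be := nz b e ltac:(clear -abc cef fn; lia).
have bf := nz b f ltac:(clear -abc cef fn; lia).
have ce := nz c e ltac:(clear -abc cef fn; lia).
have cf := nz c f ltac:(clear -abc cef fn; lia).
have ef := nz e f ltac:(clear -abc cef fn; lia).
have xy : dcross a c e f * dcross a b c f = dcross a b e f.
  by rewrite /dcross; field; rewrite ac ae bf cf.
rewrite xy.
rewrite (@onem_dcross a b e f) ?(@onem_dcross a b c f) ?(@onem_dcross a c e f);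
  try by clear -abc cef fn; lia.
have -> : dcross a c e f * (d a f * d b c / (d a c * d b f))
    / (d a f * d b e / (d a e * d b f)) = dcross b c e f.
  by rewrite /dcross; field; rewrite ac ae bf cf be af.
have -> : dcross a b c f * (d a f * d c e / (d a e * d c f))
    / (d a f * d b e / (d a e * d b f)) = dcross a b c e.
  by rewrite /dcross; field; rewrite ac ae bf cf be af.
move=> h; lra.
Qed.

Lemma rogers4_refl a b c : rogers4 a a b c = 0.
Proof.
have /eqP := d_anti a a; rewrite -addr_eq0 -mulr2n mulrn_eq0 /= => /eqP da.
by rewrite /rogers4 /dcross da !mul0r RogersL0.
Qed.

(* At i = 0 the points 0 and i coincide, and the relation still holds because
   the degenerate terms are L(0) = 0. *)
Lemma rogers4_base i j k : (i.+1 < j < k)%N -> (k < n)%N ->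
  rogers4 i i.+1 j k = rogers4 0 i.+1 j k - rogers4 0 i j k
    + rogers4 0 i i.+1 k - rogers4 0 i i.+1 j.
Proof.
case: i => [|i] ijk kn; last by apply: rogers4_cocycle; lia.
by rewrite !rogers4_refl !subr0 addr0.
Qed.

(** Induction on N. Expanded from 0, the new column j = N has two parts: one raises the last index
    on the right from N to N + 1, the other telescopes to the new summand i = N - 1. *)
Lemma sum_rogers4 N : (N < n)%N ->
  \sum_(0 <= j < N) \sum_(0 <= i < j.-1) rogers4 i i.+1 j j.+1
    = \sum_(0 <= i < N.-1) rogers4 0 i i.+1 N.
Proof.
elim: N => [|N IH] Nn; first by rewrite !big_geq.
rewrite big_nat_recr //= IH; last lia.
case: N => [|N] in IH Nn *; first by rewrite !big_geq // addr0.
rewrite /= [X in _ + X](@eq_big_nat _ _ _ _ _ _ (fun i =>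
  (rogers4 0 i.+1 N.+1 N.+2 - rogers4 0 i N.+1 N.+2)
  + (rogers4 0 i i.+1 N.+2 - rogers4 0 i i.+1 N.+1))); last first.
  by move=> i iN; rewrite rogers4_base ?addrA //; lia.
rewrite big_split /= telescope_sumr // sumrB rogers4_refl subr0.
rewrite big_nat_recr //=; ring.
Qed.

End Cocycle.

(** * Order on the projective line *)

Section P1Order.
Variable R : realType.
Implicit Types x y w : P1 R.

Lemma pdiff_gt0 x y : P1_lt x y -> 0 < pdiff y x.
Proof.
by case: x y => [a|] [b|] //= ab; rewrite /pdiff /= ?mulr1 ?mulr0 ?mul1r ?subr0
  ?subr_gt0 ?ltr01.
Qed.

Lemma pdiffC x y : pdiff y x = - pdiff x y.
Proof. by rewrite /pdiff opprB. Qed.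

Lemma P1_lt_trans x y w : P1_lt x y -> P1_lt y w -> P1_lt x w.
Proof. by case: x y w => [a|] [b|] [c|] //=; exact: lt_trans. Qed.

Lemma P1_lt_total x y : x != y -> P1_lt x y || P1_lt y x.
Proof.
by case: x y => [a|] [b|] //= ab; rewrite -neq_lt; apply: contra_neq ab => ->.
Qed.

Lemma P1_lt_asym x y : P1_lt x y -> ~~ P1_lt y x.
Proof. by case: x y => [a|] [b|] //= /ltW; rewrite leNgt. Qed.

End P1Order.

(** Counts the pairs with i + 1 < j <= N; the truncated predecessor contributes 0 at j = 0. *)
Lemma sum_predn (R : realType) N :
  \sum_(0 <= j < N.+1) (j.-1)%:R = (N%:R * (N%:R - 1)) / 2 :> R.
Proof.
elim: N => [|N IH]; first by rewrite big_nat1 !mul0r.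
by rewrite big_nat_recr //= IH; field.
Qed.

(** * Configurations in the standard cell *)

Section Config.
Variables (R : realType) (m : nat) (z : conf R m.+1).
Hypothesis zc : cyclically_ordered z.

Let zn k : P1 R := z (inord k).

(* Sign of the representative of z_k in R^2 that makes all the determinants
   of pairs positive: it flips once the sequence has passed infinity. *)
Let sgn k : R := (-1) ^+ ~~ ((k == 0)%N || P1_lt (zn 0) (zn k)).

Let det i j := sgn i * sgn j * pdiff (zn j) (zn i).

Let zn_neq i j : (i < j < m.+1)%N -> zn i != zn j.
Proof.
move=> ij; apply/eqP => e.
have /injectiveP inj := conf_inj z.
have [im jm] : (i < m.+1 /\ j < m.+1)%N by lia.
by move: (inj _ _ e) => /(congr1 val) /=; rewrite !inordK //; lia.
Qed.

Let det_gt0 i j : (i < j < m.+1)%N -> 0 < det i j.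
Proof.
move=> ij; rewrite /det /sgn; have -> : (j == 0)%N = false by lia.
case: i ij => [|i] ij /=.
  have := P1_lt_total (zn_neq ij); case h: (P1_lt (zn 0) (zn j)) => /=.
    by move=> _; rewrite expr0 !mul1r pdiff_gt0.
  by move=> h'; rewrite expr1 mul1r mulN1r -pdiffC pdiff_gt0.
have := P1_lt_total (@zn_neq 0 i.+1 ltac:(lia)).
have := P1_lt_total (@zn_neq 0 j ltac:(lia)).
have : cyclic3 (zn 0) (zn i.+1) (zn j) by apply: zc; rewrite !inordK //; lia.
rewrite /cyclic3.
(* Cases by whether each point still lies above [zn 0]. If only the first does, then [zn j] < [zn 0]
   < [zn i.+1] and the sign flips; if only the second does, the cyclic order is violated; otherwise
   the signs cancel and the points are in increasing order. *)
case a: (P1_lt (zn 0) (zn i.+1)); case b: (P1_lt (zn 0) (zn j));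
  rewrite /= ?expr0 ?expr1 ?andbF ?andbT ?orbF.
- by rewrite (negbTE (P1_lt_asym b)) andbF !orbF !mul1r => /pdiff_gt0.
- move=> _ j0 _; rewrite mul1r mulN1r -pdiffC pdiff_gt0 //.
  exact: P1_lt_trans j0 a.
- by rewrite (negbTE (P1_lt_asym b)) andbF.
- by move=> /andP[/pdiff_gt0 ? _] _ _; rewrite mulrNN !mul1r.
Qed.

Let det_anti i j : det j i = - det i j.
Proof. by rewrite /det /pdiff; ring. Qed.

Let det_plucker a b c e : det a b * det c e + det a e * det b c = det a c * det b e.
Proof. by rewrite /det /pdiff; ring. Qed.

Let sgn_neq0 k : sgn k != 0. Proof. by rewrite /sgn signr_eq0. Qed.

(** Each of the four signs occurs once above and once below the fraction bar, and the reversed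
    differences change sign in pairs. *)
Lemma cross_ratioE (i j : 'I_m.+1) :
  cross_ratio z i j = det i (ordS j) * det (ordS i) j
                      / (det i j * det (ordS i) (ordS j)).
Proof.
have zE (k : 'I_m.+1) : z k = zn k by rewrite /zn inord_val.
rewrite /cross_ratio !zE /det.
have k0 : sgn i * sgn (ordS i) * sgn j * sgn (ordS j) != 0 by rewrite !mulf_neq0.
have S (k p q p' q' : R) : k != 0 -> p' = k * p -> q' = k * q -> p / q = p' / q'.
  by move=> ? -> ->; rewrite -mulf_div divff // mul1r.
by apply: (S _ _ _ _ _ k0); rewrite /pdiff; ring.
Qed.

Lemma ordS_lt (i : 'I_m.+1) : (i < m)%N -> ordS i = i.+1 :> nat.
Proof. by move=> im; rewrite /= modn_small. Qed.

Lemma ordS_last (i : 'I_m.+1) : i = m :> nat -> ordS i = 0 :> nat.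
Proof. by move=> /= ->; rewrite modnn. Qed.

(** The last index is special: for j = m the successor of j wraps around to 0, which excludes i =
    0. *)
Lemma chiE (p : 'I_m.+1 * 'I_m.+1) : (p \in chi m.+1) =
  if (p.2 < m)%N then (p.1.+1 < p.2)%N else (0 < p.1)%N && (p.1.+1 < m)%N.
Proof.
case: p => i j; rewrite inE /= !inE -!val_eqE.
have jm := ltn_ord j; have im := ltn_ord i.
have [ij|ji] := ltnP i j; last by case: ifP => jm' /=; lia.
rewrite /= (modn_small (m := i.+1)); last lia.
case: ifP => jm'; first by rewrite modn_small; lia.
have -> : (j : nat) = m by lia.
rewrite modnn; lia.
Qed.

(** For j < m the coordinate is 1 - v(i,i+1,j,j+1), and reflection applies. For j = m the wrap to 0
    makes it v(0,i,i+1,m) itself. *)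
Lemma RogersL_cross_ratio (p : 'I_m.+1 * 'I_m.+1) : p \in chi m.+1 ->
  RogersL (cross_ratio z p.1 p.2) =
    if (p.2 < m)%N then RogersL 1 - rogers4 det p.1 p.1.+1 p.2 p.2.+1
    else rogers4 det 0 p.1 p.1.+1 m.
Proof.
case: p => i j; rewrite chiE /= cross_ratioE => hij.
have jm := ltn_ord j; have im := ltn_ord i.
rewrite (ordS_lt (i := i)); last first.
  by case: ifP hij => jm' hij; clear -jm im jm' hij; lia.
case: ifP hij => jm' hij.
  rewrite ordS_lt // -(onem_dcross det_gt0 det_plucker); [|lia..].
  have h : 0 < dcross det i i.+1 j j.+1 < 1.
    by apply: (dcross_itv det_gt0 det_plucker); lia.
  by rewrite -(RogersL_reflection h) /rogers4 addrAC subrr add0r.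
have jE : (j : nat) = m by lia.
rewrite ordS_last // jE /rogers4 /dcross; congr RogersL.
rewrite (det_anti 0 i) (det_anti 0 i.+1) !mulrN mulNr.
by rewrite invrN mulrNN [det i m * _]mulrC.
Qed.

Lemma sum_chi (F : nat -> nat -> R) :
  \sum_(p in chi m.+1) F p.1 p.2 =
    \sum_(0 <= j < m) \sum_(0 <= i < j.-1) F i j
    + \sum_(1 <= i < m.-1) F i m.
Proof.
have -> : \sum_(p in chi m.+1) F p.1 p.2
    = \sum_(j < m.+1) \sum_(i < m.+1 | (i, j) \in chi m.+1) F i j.
  rewrite (exchange_big_dep predT) //= pair_big_dep /=.
  by apply: eq_bigl => -[].
(* Turns a filtered sum over ordinals into a sum over an interval of naturals. *)
have W (P : nat -> bool) a b j : (b <= m.+1)%N ->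
    (forall i, (i < m.+1)%N -> P i = (a <= i < b)%N) ->
    \sum_(i < m.+1 | P i) F i j = \sum_(a <= i < b) F i j.
  move=> bm PE; rewrite -(big_mkord P (F ^~ j)).
  rewrite big_nat_cond [RHS]big_nat_cond.
  rewrite (big_nat_widen _ _ _ _ _ bm) (@big_nat_widenl _ _ _ a 0) //.
  rewrite big_nat_cond [RHS]big_nat_cond.
  apply: eq_bigl => i; case im: (i < m.+1)%N; rewrite ?andbF //=.
  by rewrite PE //; lia.
rewrite big_ord_recr /= big_mkord; congr (_ + _).
  apply: eq_bigr => j _.
  rewrite (eq_bigl (fun i : 'I_m.+1 => (i.+1 < j)%N)); last first.
    by move=> i; rewrite chiE /= ltn_ord.
  apply: (W (fun i => (i.+1 < j)%N)); have := ltn_ord j; lia.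
rewrite (eq_bigl (fun i : 'I_m.+1 => (0 < i)%N && (i.+1 < m)%N)); last first.
  by move=> i; rewrite chiE /= ltnn.
apply: (W (fun i => (0 < i)%N && (i.+1 < m)%N)); lia.
Qed.

Lemma sum_RogersL_cross_ratio : (2 < m)%N ->
  \sum_(p in chi m.+1) RogersL (cross_ratio z p.1 p.2)
    = (m%:R - 2) * (m%:R - 1) / 2 * RogersL 1.
Proof.
move=> m2; pose F (i j : nat) := if (j < m)%N
  then RogersL 1 - rogers4 det i i.+1 j j.+1 else rogers4 det 0 i i.+1 m.
rewrite (eq_bigr (fun p : 'I_m.+1 * 'I_m.+1 => F p.1 p.2));
  last exact: RogersL_cross_ratio.
rewrite sum_chi (@eq_big_nat _ _ _ 0 m _ (fun j => (j.-1)%:R * RogersL 1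
    - \sum_(0 <= i < j.-1) rogers4 det i i.+1 j j.+1)); last first.
  move=> j jm; have {}jm : (j < m)%N by lia.
  rewrite (eq_bigr (fun i => RogersL 1 - rogers4 det i i.+1 j j.+1)).
    by rewrite sumrB sumr_const_nat subn0 mulr_natl.
  by move=> i _; rewrite /F jm.
(* The telescoped sum is exactly what the chords ending at m contribute; the two cancel, leaving
   L(1) times the number of chords with j < m. *)
rewrite sumrB -mulr_suml (sum_rogers4 det_gt0 det_anti det_plucker) //.
rewrite [X in _ + X](_ : _ = \sum_(0 <= i < m.-1) rogers4 det 0 i i.+1 m).
  case: m m2 => // k _; rewrite addrNK sum_predn -natr1.
  by congr (_ * _); field.
(* The chords ending at m start at i = 1; the extra term at i = 0 is L(0) = 0. *)
rewrite [RHS]big_ltn; last lia.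
rewrite rogers4_refl // add0r; apply: eq_bigr => i _.
by rewrite /F ltnn.
Qed.

End Config.

Theorem mainTheorem1 (R : realType) (n : nat) (hn : (4 <= n)%N)
    (P : M0 R n) (hP : standard_cell P) :
  \sum_(p in chi n) RogersL (dihedral_coord P p.1 p.2)
    = (n%:R - 3) * (n%:R - 2) / 2 * RogersL (1 : R).
Proof.
case: hP => z -> zc; case: n hn P z zc => // m hn P z zc.
under eq_bigr do rewrite dihedral_coordE.
rewrite (sum_RogersL_cross_ratio zc) // -natr1.
by congr (_ * _ / _ * _); ring.
Qed.
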